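(* Let $n\ge 0$ and $1\le b\le n$, and for $0\le k\le\lfloor n/2\rfloor$ define $$e^{(b)}_{n-k,k}=\begin{cases}\sum_{t=1}^{n-2}S_{\ge2}(n-t,b-t) & k=1,\\[2pt] \sum_{t=k}^{n-k}S_{\ge2}(n-t,b-t) & k=0\text{ or }k>1.\end{cases}$$ Then $$\sum_{\pi\in\mathcal{PS}et(n,b)}\mathbf{q}^{\mathrm{Desing}(\pi)}=\sum_{k=0}^{\lfloor n/2\rfloor}e^{(b)}_{n-k,k}\left(\sum_{T\in\mathrm{SYT}(n-k,k)}\mathbf{q}^{\mathrm{Des}(T)}\right),$$ and consequently $$\sum_{\pi\in\mathcal{PS}et(n,b)}\mathcal{F}_{n,\mathrm{Desing}(\pi)}=\sum_{k=0}^{\lfloor n/2\rfloor}e^{(b)}_{n-k,k}\,s_{(n-k,k)} .$$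
   Context: $[n]=\{1,\dots,n\}$. $\mathcal{PS}et(n,b)$ is the set of set partitions of $[n]$ with exactly $b$ blocks. For a set partition $\pi$ of $[n]$, $\mathrm{Sing}(\pi)$ is the set of elements $i$ such that $\{i\}$ is a block of $\pi$, and $\mathrm{Desing}(\pi)=\{i\in[n-1] : i\in\mathrm{Sing}(\pi),\ i+1\notin\mathrm{Sing}(\pi)\}$. $S_{\ge2}(m,c)$ (associated Stirling number of the second kind) is the number of set partitions of $[m]$ into exactly $c$ blocks, each of size at least $2$; in particular $S_{\ge2}(0,0)=1$ and $S_{\ge2}(m,c)=0$ if $c<0$. $\mathrm{SYT}(n-k,k)$ is the set of standard Young tableaux of shape $(n-k,k)$ (one-row shape $(n)$ if $k=0$), drawn in English notation, and $\mathrm{Des}(T)=\{i : i+1 \text{ is in a lower row of } T \text{ than } i\}$. For $A\subseteq[n-1]$, $\mathbf{q}^A=\prod_{i\in A}q_i$, where $q_1,\dots,q_{n-1}$ are commuting variables. For $D\subseteq[n-1]$, $\mathcal{F}_{n,D}=\sum x_{i_1}\cdots x_{i_n}$, summed over $i_1\le\dots\le i_n$ with $i_j<i_{j+1}$ whenever $j\in D$ (fundamental quasi-symmetric function). $s_\lambda$ is the Schur function. *)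

(* Defs.v *)
From HB Require Import structures.
From mathcomp Require Import all_boot all_order all_algebra finmap.
From mathcomp Require Import mpoly.

Set Implicit Arguments.
Unset Strict Implicit.
Unset Printing Implicit Defensive.

Import GRing.Theory Num.Theory.
Local Open Scope ring_scope.

(* The element i of [n] = {1, ..., n} is the ordinal i - 1 of 'I_n, and the
   element i of [n-1] is the ordinal i - 1 of 'I_n.-1.  For i in [n-1], [elt i]
   and [elt_succ i] are the elements i and i + 1 of [n]. *)
Definition elt n (i : 'I_n.-1) : 'I_n := widen_ord (leq_pred n) i.

Lemma elt_succ_proof n (i : 'I_n.-1) : (i.+1 < n)%N.
Proof. by rewrite -ltn_predRL ltn_ord. Qed.

Definition elt_succ n (i : 'I_n.-1) : 'I_n := Ordinal (elt_succ_proof i).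

(* q^A, where q_1, ..., q_{n-1} are the variables of {mpoly int[n.-1]}. *)
Definition qpow n (A : {set 'I_n.-1}) : {mpoly int[n.-1]} :=
  \prod_(i in A) 'X_i.

Definition PSet n b : {set {set {set 'I_n}}} :=
  [set P | partition P [set: 'I_n] & #|P| == b].

Definition Sing n (P : {set {set 'I_n}}) : {set 'I_n} :=
  [set i | [set i] \in P].

Definition Desing n (P : {set {set 'I_n}}) : {set 'I_n.-1} :=
  [set i | (elt i \in Sing P) && (elt_succ i \notin Sing P)].

(* The number of blocks is an integer because the coefficients below involve
   S_{>=2}(n - t, b - t) with b < t. *)
Definition stirling_ge2 (m : nat) (c : int) : nat :=
  #|[set P : {set {set 'I_m}} | [&& partition P [set: 'I_m],
       #|P|%:Z == c & [forall B in P, 2 <= #|B|]%N]]|.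

Definition ecoef (n b k : nat) : nat :=
  (if k == 1 then
     \sum_(1 <= t < n.-1) stirling_ge2 (n - t) (b%:Z - t%:Z)
   else
     \sum_(k <= t < (n - k).+1) stirling_ge2 (n - t) (b%:Z - t%:Z))%N.

(* The cells of the diagram of la, rows being numbered from top to bottom. *)
Definition cell (la : seq nat) := {r : 'I_(size la) & 'I_(nth 0%N la r)}.
Definition crow la (c : cell la) : nat := tag c.
Definition ccol la (c : cell la) : nat := tagged c.

Definition two_row (n k : nat) : seq nat :=
  if k == 0%N then [:: n] else [:: (n - k)%N; k].

(* The requirement that every element of 'I_n occurs exactly once forces la to
   have size n. *)
Definition SYT n (la : seq nat) : {set {ffun cell la -> 'I_n}} :=
  [set T : {ffun cell la -> 'I_n} | [&& [forall i, #|[set c | T c == i]| == 1%N],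
     [forall c, forall d,
        (crow c == crow d) && (ccol c < ccol d)%N ==> (T c < T d)%N] &
     [forall c, forall d,
        (ccol c == ccol d) && (crow c < crow d)%N ==> (T c < T d)%N]]].

Definition Des n la (T : {ffun cell la -> 'I_n}) : {set 'I_n.-1} :=
  [set i | [exists c, exists d,
     [&& T c == elt i, T d == elt_succ i & (crow c < crow d)%N]]].

(* Formal power series with integer coefficients in x_0, x_1, x_2, ..., given
   by their coefficients; a monomial is the finitely supported family of its
   exponents. *)
Definition monom := {fsfun nat -> nat with 0%N}.
Definition series := monom -> int.

(* The monomial \prod_i x_(f i). *)
Definition xmonom (I : finType) (f : {ffun I -> nat}) : monom :=
  [fsfun v in [fset f i | i in I]%fset => #|[set i | f i == v]|].

(* The series \sum_(f | A f) \prod_i x_(f i).  Only the finitely many f with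
   values in the support of m can have \prod_i x_(f i) = m, whence the encoding
   (see [genseriesE]). *)
Definition genseries (I : finType) (A : pred {ffun I -> nat}) : series :=
  fun m => #|[set g : {ffun I -> finsupp m} |
      A [ffun i => val (g i)] & xmonom [ffun i => val (g i)] == m]|%:R.

Lemma xmonomE (I : finType) (f : {ffun I -> nat}) v :
  xmonom f v = #|[set i | f i == v]|.
Proof.
rewrite fsfunE; case: ifP => // /negP nv; apply/esym/eqP.
rewrite cards_eq0; apply/eqP/setP => i; rewrite !inE.
by apply/negP => /eqP fi; apply: nv; apply/imfsetP; exists i.
Qed.

Lemma genseriesE (I : finType) (A : pred {ffun I -> nat}) (m : monom)
    (s : seq {ffun I -> nat}) :
    uniq s -> (forall f, (f \in s) = A f && (xmonom f == m)) ->
  genseries A m = (size s)%:R.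
Proof.
move=> us sP; rewrite /genseries; congr _%:R.
pose h (g : {ffun I -> finsupp m}) : {ffun I -> nat} := [ffun i => val (g i)].
have h_inj : injective h.
  by move=> g1 g2 /ffunP e; apply/ffunP => i; apply: val_inj; have := e i;
     rewrite !ffunE.
rewrite cardE -(size_map h); apply: perm_size; apply: uniq_perm => //.
  by rewrite map_inj_uniq // enum_uniq.
move=> f; rewrite sP; apply/mapP/andP => [[g]|[Af /eqP fm]].
  by rewrite mem_enum inE => /andP[Ag gm] ->.
have fs i : f i \in finsupp m.
  rewrite -fm mem_finsupp xmonomE cards_eq0.
  by apply/set0Pn; exists i; rewrite inE.
have hE : h [ffun i => [` fs i]%fset] = f by apply/ffunP => i; rewrite !ffunE.
by exists [ffun i => [` fs i]%fset]; rewrite ?hE // mem_enum inE -/(h _) hE Af fm /=.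
Qed.

Definition fundamental n (D : {set 'I_n.-1}) : series :=
  genseries (fun w : {ffun 'I_n -> nat} =>
    [forall i : 'I_n, forall j : 'I_n, (i <= j)%N ==> (w i <= w j)%N] &&
    [forall j in D, (w (elt j) < w (elt_succ j))%N]).

Definition semistandard la (T : {ffun cell la -> nat}) : bool :=
  [forall c, forall d,
     (crow c == crow d) && (ccol c < ccol d)%N ==> (T c <= T d)%N] &&
  [forall c, forall d,
     (ccol c == ccol d) && (crow c < crow d)%N ==> (T c < T d)%N].

Definition schur (la : seq nat) : series := genseries (@semistandard la).

(* Main.v *)
(* Grouping the set partitions of [n] by their set A of singletons, the left-hand
   side is the sum of S_{>=2}(n - |A|, b - |A|) q^{D(A)} over all subsets A, where
   D(A) = {i : i in A, i + 1 not in A}.  Read the elements of A as opening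
   brackets and the other elements as closing brackets, and let R be the set of
   matched closing brackets.  For fixed t, the map A |-> R is a bijection from
   the subsets of size t onto the ballot sets R with |R| <= t <= n - |R|, and
   D(A) = {i : i not in R, i + 1 in R}.  Ballot sets of size k are the second rows
   of the standard tableaux T of shape (n - k, k), and this set is then Des(T).
   The quasi-symmetric identity follows from the same equidistribution and the
   expansion s_la = \sum_T F_{Des(T)}, obtained by standardization. *)
Require Import Defs.
From mathcomp Require Import all_boot all_order all_algebra finmap.
From mathcomp Require Import mpoly.
From mathcomp Require Import zify.

Set Implicit Arguments.
Unset Strict Implicit.
Unset Printing Implicit Defensive.

Import GRing.Theory.

(** * Bracket matching *)

(* The number of opening brackets [i < m], [p i], not yet matched by a closing
   bracket [i < m], [~~ p i]. *)
Fixpoint unmatched (p : pred nat) (m : nat) : nat :=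
  if m is m'.+1 then
    if p m' then (unmatched p m').+1 else (unmatched p m').-1
  else 0.

(** The closing brackets that have a partner. The truncation of [.-1] in [unmatched] lets a closing
    bracket without partner leave the count at 0. *)
Definition closing (p : pred nat) : pred nat :=
  fun i => ~~ p i && (0 < unmatched p i).

Definition npref (p : pred nat) (m : nat) : nat := \sum_(i < m) p i.

Lemma nprefS p m : npref p m.+1 = npref p m + p m.
Proof. by rewrite /npref big_ord_recr. Qed.

Lemma npref0 p : npref p 0 = 0.
Proof. exact: big_ord0. Qed.

Lemma eq_npref p q m : (forall i, i < m -> p i = q i) -> npref p m = npref q m.
Proof. by move=> e; apply: eq_bigr => i _; rewrite e. Qed.

Lemma eq_unmatched p q m :
  (forall i, i < m -> p i = q i) -> unmatched p m = unmatched q m.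
Proof.
elim: m => //= m IHm e; rewrite e // IHm // => i im.
by apply: e; apply: ltnW.
Qed.

Lemma eq_closing p q m i :
  (forall i, i < m -> p i = q i) -> i < m -> closing p i = closing q i.
Proof.
move=> e im; rewrite /closing e // (@eq_unmatched p q) // => j ji.
by apply: e; apply: ltn_trans im.
Qed.

(** An opening bracket among the first [m] positions is either matched there or still unmatched. *)
Lemma npref_closing p m : npref (closing p) m + unmatched p m = npref p m.
Proof.
elim: m => [|m IHm]; rewrite ?npref0 // !nprefS /= -IHm /closing.
by case: (p m); case: (unmatched p m) => /= *; lia.
Qed.

(** Matched closing brackets and opening brackets occupy distinct positions. *)
Lemma npref_closing_le p m : npref (closing p) m + npref p m <= m.
Proof.
elim: m => [|m IHm]; rewrite ?npref0 // !nprefS.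
have := npref_closing p m; move: IHm; rewrite /closing.
by case: (p m); case: (unmatched p m) => /= *; lia.
Qed.

Lemma closing_ballot p m : 2 * npref (closing p) m <= m.
Proof. by have := npref_closing p m; have := npref_closing_le p m; lia. Qed.

(** An opening bracket at [i] is matched by a closing one at [i.+1]. Conversely, an unmatched
    closing bracket at [i] leaves nothing open, so if [i.+1] is matched and [i] is not in
    [closing p], then [i] opens. *)
Lemma closing_descent p i :
  ~~ closing p i && closing p i.+1 = p i && ~~ p i.+1.
Proof.
rewrite /closing /=.
by case: (p i) (p i.+1) => [] []; case: (unmatched p i).
Qed.

(** Decided from the last position backwards. If only [p] opened at [m], then [q] would close there
    without partner, so all its earlier openings would be matched, and [p] would have fewer openings
    before [m] than matched closings. *)
Lemma closing_inj p q m :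
    (forall i, i < m -> closing p i = closing q i) ->
    npref p m = npref q m ->
  forall i, i < m -> p i = q i.
Proof.
elim: m => // m IHm e; rewrite !nprefS => s.
have e' i : i < m -> closing p i = closing q i by move=> im; apply: e; apply: ltnW.
have := npref_closing p m; have := npref_closing q m.
rewrite (eq_npref e') => cp cq.
have pq : p m = q m.
  have := e m (ltnSn m); rewrite /closing.
  by case: (p m) (q m) s => [] [] //=; lia.
move=> i; rewrite ltnS leq_eqVlt => /predU1P [-> //|]; apply: IHm => //.
by move: s; rewrite pq => /addIn.
Qed.

Lemma closing_surj r m t :
    (forall j, j <= m -> 2 * npref r j <= j) ->
    npref r m <= t -> npref r m + t <= m ->
  exists p, npref p m = t /\ forall i, i < m -> closing p i = r i.
Proof.
elim: m t => [|m IHm] t ball; rewrite ?npref0 ?nprefS => tl tu.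
  by exists r; rewrite npref0; split => //; lia.
have ball' j : j <= m -> 2 * npref r j <= j.
  by move=> jm; apply: ball; apply: leqW.
have bm := ball' m (leqnn m).
(* The last bracket is forced: outside [r] it opens exactly when some of the [t] openings stay
   unmatched. Otherwise [t = npref r m], the bracket closes without partner, and [bm] gives the
   upper bound needed for the prefix. *)
pose x := ~~ r m && (npref r m < t).
have xt : x <= t by rewrite /x; case: (r m) => //=; lia.
have [||p [pt pr]] := IHm (t - x) ball'.
- by move: tl tu; rewrite /x; case: (r m) => /=; lia.
- by move: tl tu; rewrite /x; case: (r m) => /=; lia.
pose q i := if i < m then p i else x.
have qp i : i < m -> q i = p i by rewrite /q => ->.
have qm : q m = x by rewrite /q ltnn.
exists q; split; first by rewrite nprefS (eq_npref qp) pt qm subnK.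
move=> i; rewrite ltnS leq_eqVlt => /predU1P [->|im]; last first.
  by rewrite (eq_closing qp im) pr.
rewrite /closing qm (eq_unmatched qp).
have := npref_closing p m; rewrite (eq_npref pr) pt /x.
by move: tl tu; rewrite /x; case: (r m) => /=; lia.
Qed.

(** * Bracket matching on subsets of ['I_n] *)

Definition indic n (A : {set 'I_n}) : pred nat :=
  fun i => [exists j in A, val j == i].

Lemma indicE n (A : {set 'I_n}) (i : 'I_n) : indic A i = (i \in A).
Proof.
apply/existsP/idP => [[j /andP[jA /eqP/val_inj <-]] //|iA].
by exists i; rewrite iA /=.
Qed.

Lemma npref_indic n (A : {set 'I_n}) : npref (indic A) n = #|A|.
Proof.
rewrite /npref -sum1_card [RHS]big_mkcond; apply: eq_bigr => i _.
by rewrite indicE; case: (i \in A).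
Qed.

Lemma npref_card n (A : {set 'I_n}) m :
  m <= n -> npref (indic A) m = #|[set i in A | i < m]|.
Proof.
move=> mn; rewrite /npref (big_ord_widen _ (fun i => nat_of_bool (indic A i)) mn).
rewrite -sum1_card [LHS]big_mkcond [RHS]big_mkcond; apply: eq_bigr => i _.
by rewrite inE indicE; case: (i \in A); case: (_ < _).
Qed.

(** The lattice-word condition: with the elements of [R] as down-steps and the others as up-steps,
    the path never goes below 0. *)
Definition ballot n (R : {set 'I_n}) : bool :=
  [forall m : 'I_n.+1, 2 * npref (indic R) m <= m].

Lemma ballotP n (R : {set 'I_n}) :
  reflect (forall m, m <= n -> 2 * npref (indic R) m <= m) (ballot R).
Proof.
apply: (iffP forallP) => [h m mn|h m]; last by apply: h; rewrite -ltnS.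
by have := h (Ordinal (mn : m < n.+1)).
Qed.

Definition closing_set n (A : {set 'I_n}) : {set 'I_n} :=
  [set i : 'I_n | closing (indic A) i].

Lemma indic_closing n (A : {set 'I_n}) i :
  i < n -> indic (closing_set A) i = closing (indic A) i.
Proof. by move=> i_n; have := indicE (closing_set A) (Ordinal i_n); rewrite inE. Qed.

(** Common form of the two statistics: [Desing P] is [fall_set (Sing P)], and [Des T] is the
    [fall_set] of the first row of a two-row tableau. *)
Definition fall_set n (A : {set 'I_n}) : {set 'I_n.-1} :=
  [set i | (elt i \in A) && (elt_succ i \notin A)].

Lemma fall_closing n (A : {set 'I_n}) :
  fall_set (~: closing_set A) = fall_set A.
Proof.
apply/setP => i; rewrite !inE negbK -!indicE /=.
exact: closing_descent.
Qed.

Lemma closing_set_inj n (A B : {set 'I_n}) :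
  #|A| = #|B| -> closing_set A = closing_set B -> A = B.
Proof.
move=> cAB AB; apply/setP => i; rewrite -!indicE.
apply: (@closing_inj _ _ n); rewrite ?npref_indic // => j jn.
by rewrite -!indic_closing // AB.
Qed.

(** Each matched closing bracket uses its own opening one, whence [#|R| <= t]; and [R] avoids the
    [t] opening positions, whence [t <= n - #|R|]. By [closing_surj] these bounds and the ballot
    condition suffice. *)
Lemma closing_set_image n t :
  @closing_set n @: [set A : {set 'I_n} | #|A| == t] =
    [set R : {set 'I_n} | ballot R & #|R| <= t <= n - #|R|].
Proof.
apply/setP => R; apply/imsetP/idP => [[A]|].
  rewrite inE => /eqP At ->.
  have e m : m <= n ->
      npref (indic (closing_set A)) m = npref (closing (indic A)) m.
    by move=> mn; apply: eq_npref => i im; rewrite indic_closing // (leq_trans im).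
  rewrite inE; apply/andP; split.
    by apply/ballotP => m mn; rewrite e // closing_ballot.
  rewrite -npref_indic e //.
  have := npref_closing (indic A) n; have := npref_closing_le (indic A) n.
  by rewrite npref_indic; lia.
rewrite inE => /and3P[/ballotP ball tl tu].
have Rn : #|R| <= n by rewrite -[X in _ <= X](card_ord n) max_card.
have [||p [pt pr]] := closing_surj (t := t) ball; rewrite ?npref_indic //; try lia.
pose A := [set i : 'I_n | p i].
have Ap i : i < n -> indic A i = p i.
  by move=> i_n; have := indicE A (Ordinal i_n); rewrite inE.
exists A; first by rewrite inE -npref_indic (eq_npref Ap) pt.
by apply/setP => i; rewrite inE (eq_closing Ap) // pr // indicE.
Qed.

(** Equidistribution for fixed [t]. The weight [G] is arbitrary so that both q-monomials and
    coefficients of fundamental series can be substituted. *)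
Lemma sum_fall_set (M : nmodType) n t (G : {set 'I_n.-1} -> M) :
  (\sum_(A : {set 'I_n} | #|A| == t) G (fall_set A) =
   \sum_(R : {set 'I_n} | ballot R && (#|R| <= t <= n - #|R|)%N)
      G (fall_set (~: R)))%R.
Proof.
transitivity (\sum_(R in @closing_set n @: [set A : {set 'I_n} | #|A| == t])
   G (fall_set (~: R)))%R.
  rewrite big_imset /=.
    by apply: eq_big => A; rewrite ?inE // fall_closing.
  move=> A B; rewrite !inE => /eqP At /eqP Bt; apply: closing_set_inj.
  by rewrite At.
by rewrite closing_set_image; apply: eq_bigl => R; rewrite inE.
Qed.

(** * Set partitions with prescribed singletons *)

Lemma partitionU (T : finType) (P Q : {set {set T}}) D E :
  partition P D -> partition Q E -> [disjoint D & E] ->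
  partition (P :|: Q) (D :|: E).
Proof.
case/and3P=> /eqP <- tP nP /and3P[/eqP <- tQ nQ] dis.
rewrite /partition inE negb_or nP nQ trivIsetU // !andbT.
by rewrite /cover bigcup_setU.
Qed.

Definition singletons (T : finType) (A : {set T}) : {set {set T}} :=
  [set [set a] | a in A].

Lemma in_singletons (T : finType) (A B : {set T}) :
  (B \in singletons A) = (B \subset A) && (#|B| == 1).
Proof.
apply/imsetP/andP => [[a aA ->]|[BA /cards1P[a Ba]]].
  by rewrite sub1set cards1.
by exists a; rewrite // -sub1set -Ba.
Qed.

Lemma partition_singletons (T : finType) (A : {set T}) :
  partition (singletons A) A.
Proof.
apply/and3P; split.
- apply/eqP/setP => x; apply/bigcupP/idP => [[B]|xA].
    by rewrite in_singletons => /andP[/subsetP BA _]; apply: BA.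
  by exists [set x]; rewrite ?set11 // imset_f.
- apply/trivIsetP => _ _ /imsetP[a _ ->] /imsetP[b _ ->] ab.
  by rewrite disjoints1 inE; apply: contraNneq ab => ->.
- by rewrite in_singletons cards0 andbF.
Qed.

Lemma Sing_subset n (P : {set {set 'I_n}}) : singletons (Sing P) \subset P.
Proof. by apply/subsetP => _ /imsetP[a + ->]; rewrite inE. Qed.

Lemma partition_nonsingletons n (P : {set {set 'I_n}}) :
  partition P [set: 'I_n] -> partition (P :\: singletons (Sing P)) (~: Sing P).
Proof.
case/and3P=> /eqP cP tP nP; apply/and3P; split; last first.
- by rewrite inE (negbTE nP) andbF.
- exact: trivIsetS (subsetDl _ _) tP.
apply/eqP/setP => x; rewrite [RHS]inE; apply/bigcupP/idP => [[B]|xA].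
  rewrite inE => /andP[BS BP] xB; apply: contra BS => xA.
  have xP : [set x] \in P by move: xA; rewrite inE.
  by rewrite -(def_pblock tP BP xB) (def_pblock tP xP (set11 x)) imset_f.
have xc : x \in cover P by rewrite cP inE.
exists (pblock P x); rewrite ?mem_pblock // inE pblock_mem // andbT.
apply: contra xA => /imsetP[a aA e].
by move: xc; rewrite -mem_pblock e inE => /eqP->.
Qed.

(** Deleting the singleton blocks leaves a partition of [~: A] into blocks of size at least 2; [Phi]
    is the inverse operation, with [~: A] enumerated by [f]. *)
Lemma card_PSet_Sing n b (A : {set 'I_n}) :
  #|[set P in PSet n b | Sing P == A]| =
    stirling_ge2 (n - #|A|) (b%:Z - #|A|%:Z)%R.
Proof.
have cAC : #|~: A| = n - #|A| by rewrite cardsCs setCK card_ord.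
rewrite -cAC /stirling_ge2.
pose f (j : 'I_#|~: A|) : 'I_n := enum_val j.
have f_inj : injective f by apply: enum_val_inj.
have f_im : f @: setT = ~: A.
  apply/setP => x; apply/imsetP/idP => [[j _ ->]|xA]; first exact: enum_valP.
  by exists (enum_rank_in xA x); rewrite // /f enum_rankK_in.
pose fQ (Q : {set {set 'I_#|~: A|}}) := [set f @: (B : {set _}) | B in Q].
pose big (Q : {set {set 'I_#|~: A|}}) := [forall B in Q, 2 <= #|B|].
pose Phi Q := fQ Q :|: singletons A.
(* The blocks coming from [Q] are recovered from [Phi Q] by their size, which makes [Phi]
   injective. *)
have fQ_big Q B : big Q -> (B \in fQ Q) = (B \in Phi Q) && (2 <= #|B|).
  move=> /'forall_implyP bQ; rewrite inE in_singletons.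
  apply/idP/andP => [BQ|[/orP[// | /andP[_ /eqP->]] //]].
  by rewrite BQ; case/imsetP: BQ => C CQ ->; rewrite card_imset // bQ.
have card_Phi Q : big Q -> #|Phi Q| = #|Q| + #|A|.
  move=> bQ; rewrite cardsU disjoint_setI0 ?cards0 ?subn0.
    by rewrite !card_imset //; [exact: set1_inj | exact: imset_inj].
  rewrite disjoint_subset; apply/subsetP => B; rewrite fQ_big // => /andP[_ B2].
  by rewrite !inE in_singletons; apply/nandP; right; lia.
have Phi_part Q : partition Q setT -> partition (Phi Q) setT.
  rewrite -(imset_partition _ _ f_inj) f_im => pQ.
  rewrite -[setT](setUCr A) setUC partitionU ?partition_singletons //.
  by rewrite -setI_eq0 setIC setICr.
set S := [set Q : {set {set 'I_#|~: A|}} | _].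
have Phi_inj : {in S &, injective Phi}.
  move=> Q Q'; rewrite !inE => /and3P[_ _ bQ] /and3P[_ _ bQ'] e.
  apply: (imset_inj (imset_inj f_inj)).
  by apply/setP => B; rewrite [LHS]fQ_big // [RHS]fQ_big // e.
rewrite -(card_in_imset Phi_inj); congr #|pred_of_set _|.
apply/setP => P; apply/idP/imsetP => [|[Q QS ->]].
  rewrite !inE => /andP[/andP[pP /eqP Pb] /eqP SP].
  pose Q := [set B : {set 'I_#|~: A|} | f @: B \in P :\: singletons A].
  have pD := partition_nonsingletons pP; rewrite SP in pD.
  have fQE : fQ Q = P :\: singletons A.
    apply/setP => B; apply/imsetP/idP => [[C CQ ->]|BP].
      by move: CQ; rewrite inE.
    have BA := partitionS pD BP.
    suff e : f @: (f @^-1: B) = B by exists (f @^-1: B); rewrite // inE e.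
    apply/setP => x; apply/imsetP/idP => [[j jB ->]|xB].
      by move: jB; rewrite inE.
    have : x \in f @: setT by rewrite f_im (subsetP BA).
    case/imsetP=> j _ xj.
    by exists j; rewrite // inE -xj.
  have PE : P = Phi Q.
    by rewrite /Phi fQE setDE setUIl (setUC (~: _)) setUCr setIT -SP;
       apply/esym/setUidPl/Sing_subset.
  (* A one-element block of [Q] would give a singleton block of [P] inside [A], and those were
     removed. *)
  have bQ : big Q.
    apply/'forall_implyP => B BQ; have : f @: B \in fQ Q by apply: imset_f.
    rewrite fQE => BP; have := partitionS pD BP => BA.
    have := partition_neq0 pD BP; rewrite -card_gt0.
    move: BP; rewrite !inE in_singletons negb_and => /andP[+ BP].
    rewrite card_imset // => /orP[nBA|]; last by case: #|B| => [|[|]].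
    move=> B0; case: (ltnP 1 #|B|) => // B1.
    have /cards1P[j Bj] : #|B| == 1 by rewrite eqn_leq B1 B0.
    have : f j \in Sing P by rewrite inE -imset_set1 -Bj.
    by move: nBA; rewrite SP Bj imset_set1 sub1set => /negP.
  exists Q => //; rewrite inE -/(big Q) bQ andbT; apply/andP; split.
    by rewrite -(imset_partition _ _ f_inj) f_im -/(fQ Q) fQE.
  by apply/eqP; have := card_Phi Q bQ; rewrite -PE Pb; lia.
move: QS; rewrite /S inE => /and3P[pQ cQ bQ]; rewrite !inE Phi_part //=.
apply/andP; split; first by rewrite card_Phi //; apply/eqP; lia.
apply/eqP/setP => x; rewrite inE; apply/idP/idP => [xP|xA]; last first.
  by rewrite inE in_singletons sub1set xA cards1 orbT.
have := fQ_big Q [set x] bQ; rewrite xP cards1 /=.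
by move: xP; rewrite inE in_singletons sub1set => /orP[->|/andP[]].
Qed.

(** * Standard tableaux with two rows *)

Lemma card_ord_lt n (k : nat) : k <= n -> #|[set i : 'I_n | i < k]| = k.
Proof.
move=> kn; rewrite -sum1_card (eq_bigl (fun i : 'I_n => i < k)).
  by rewrite (big_ord_narrow kn) sum1_card card_ord.
by move=> i; rewrite inE.
Qed.

Lemma cell_eq la (c d : cell la) : crow c = crow d -> ccol c = ccol d -> c = d.
Proof.
case: c d => r j [s k]; rewrite /crow /ccol /= => /val_inj rs.
by case: s / rs k => k /= /val_inj ->.
Qed.

Lemma ccol_lt la (c : cell la) : ccol c < nth 0 la (crow c).
Proof. exact: ltn_ord. Qed.

Lemma cell_exists la r j :
  j < nth 0 la r -> exists c : cell la, crow c = r /\ ccol c = j.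
Proof.
move=> jr; have rs : r < size la.
  by case: (ltnP r (size la)) jr => // ?; rewrite nth_default.
by exists (Tagged (fun r : 'I_(size la) => 'I_(nth 0 la r))
             (Ordinal jr : 'I_(nth 0 la (Ordinal rs)))).
Qed.

Lemma card_cell la : #|{: cell la}| = sumn la.
Proof.
rewrite card_tagged; congr sumn; rewrite -[RHS](mkseq_nth 0) /mkseq.
rewrite -val_enum_ord -map_comp; apply: eq_map => r /=.
by rewrite card_ord.
Qed.

Lemma card_row_prefix la r k : k <= nth 0 la r ->
  #|[set c : cell la | (crow c == r) && (ccol c < k)]| = k.
Proof.
move=> kr; case: (ltnP r (size la)) => rs; last first.
  move: kr; rewrite nth_default // leqn0 => /eqP->.
  by apply/eqP; rewrite cards_eq0; apply/eqP/setP => c; rewrite !inE andbF.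
pose h (j : 'I_(nth 0 la (Ordinal rs))) : cell la :=
  Tagged (fun r : 'I_(size la) => 'I_(nth 0 la r)) j.
have h_inj : injective h by move=> i j /(congr1 (@ccol la)) /val_inj.
rewrite -[RHS](card_ord_lt (n := nth 0 la (Ordinal rs)) kr) -(card_imset _ h_inj).
congr #|pred_of_set _|; apply/setP => c; rewrite inE.
apply/andP/imsetP => [[/eqP cr ck]|[j + ->]]; last by rewrite inE eqxx.
have cj : ccol c < nth 0 la (Ordinal rs) by rewrite /= -cr ccol_lt.
by exists (Ordinal cj); rewrite ?inE //; apply: cell_eq.
Qed.

Section StandardTableaux.
Variables (n : nat) (la : seq nat) (T : {ffun cell la -> 'I_n}).

(** One-element fibres amount to bijectivity, the form used from here on. *)
Lemma SYTP :
  reflect [/\ bijective T,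
     forall c d, crow c = crow d -> ccol c < ccol d -> T c < T d &
     forall c d, ccol c = ccol d -> crow c < crow d -> T c < T d]
    (T \in SYT n la).
Proof.
rewrite inE; apply: (iffP and3P) => [[/forallP b r c]|[[g gK Kg] r c]]; split.
- have fib i : exists x, [set c | T c == i] = [set x] by apply/cards1P/b.
  apply: inj_card_bij => [x y xy|].
    have [z zP] := fib (T x).
    have: x \in [set c | T c == T x] by rewrite inE.
    have: y \in [set c | T c == T x] by rewrite inE xy.
    by rewrite zP !inE => /eqP -> /eqP ->.
  rewrite -[X in _ <= X]cardsT -[X in X <= _]cardsT.
  have /fin_all_exists [f fP] : forall i, exists x, T x = i.
    move=> i; have [x xP] := fib i; exists x; apply/eqP.
    by have := set11 x; rewrite -xP inE.
  have f_inj : injective f by apply: can_inj fP.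
  by rewrite -(card_imset _ f_inj); apply/subset_leq_card/subsetT.
- by move=> x y /eqP xr xc; move/'forall_forallP: r => /(_ x y); rewrite xr xc.
- by move=> x y /eqP xr xc; move/'forall_forallP: c => /(_ x y); rewrite xr xc.
- apply/forallP => i; apply/cards1P; exists (g i); apply/setP => x.
  by rewrite !inE; apply/eqP/eqP => [<-|->]; rewrite ?gK.
- by apply/'forall_forallP => x y; apply/implyP => /andP[/eqP]; apply: r.
- by apply/'forall_forallP => x y; apply/implyP => /andP[/eqP]; apply: c.
Qed.

End StandardTableaux.

(** * Second rows of two-row tableaux as ballot sets *)

Definition second_row n la (T : {ffun cell la -> 'I_n}) : {set 'I_n} :=
  T @: [set c | crow c == 1].

Section TwoRow.
Variables (n k : nat) (kn : k.*2 <= n).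
Let la := two_row n k.

(** For [k = 0] the missing second row is read as the default 0, so the one-row shape needs no
    separate treatment below. *)
Lemma nth_two_row r :
  nth 0 la r = if r == 0 then n - k else if r == 1 then k else 0.
Proof.
rewrite /la /two_row; case: eqP => [->|_]; last by case: r => [|[|[]]].
by case: r => [|[|r]] //=; rewrite ?subn0 // nth_nil.
Qed.

Lemma crow_two_row (c : cell la) : crow c = (crow c == 1).
Proof. by have := ccol_lt c; rewrite nth_two_row; case: (crow c) => [|[]]. Qed.

Lemma eq_crow_two_row (c d : cell la) :
  (crow c == crow d) = ((crow c == 1) == (crow d == 1)).
Proof.
rewrite (crow_two_row c) (crow_two_row d).
by case: (crow c == 1) (crow d == 1) => [] [].
Qed.

Lemma sumn_two_row : sumn la = n.
Proof. by rewrite /la /two_row; case: eqP => //= _; lia. Qed.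

Section Row.
Variables (T : {ffun cell la -> 'I_n}) (ST : T \in SYT n la).

Lemma mem_second_row c : (T c \in second_row T) = (crow c == 1).
Proof.
by have /SYTP[/bij_inj Ti _ _] := ST; rewrite mem_imset // inE.
Qed.

Lemma card_second_row : #|second_row T| = k.
Proof.
have /SYTP[/bij_inj Ti _ _] := ST; rewrite card_imset //.
have := @card_row_prefix la 1 k; rewrite nth_two_row /= => /(_ (leqnn _)) e.
rewrite -[RHS]e; congr #|pred_of_set _|; apply/setP => c; rewrite !inE.
case: eqP => //= c1; have := ccol_lt c; rewrite nth_two_row c1 /=.
by move->.
Qed.

(** With two rows, moving to a lower row means passing from the first row to the second. *)
Lemma Des_two_row : Des T = fall_set (~: second_row T).
Proof.
have /SYTP[[g gK Kg] _ _] := ST.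
apply/setP => i; rewrite !inE negbK; apply/existsP/andP.
  case=> c /existsP[d /and3P[/eqP<- /eqP<-]].
  rewrite !mem_second_row (crow_two_row c) (crow_two_row d).
  by case: (crow c == 1) (crow d == 1) => [] [].
rewrite -{1}(Kg (elt i)) -{1}(Kg (elt_succ i)) !mem_second_row => -[ci di].
exists (g (elt i)); apply/existsP; exists (g (elt_succ i)).
rewrite !Kg !eqxx /= (crow_two_row (g (elt i))) (crow_two_row (g (elt_succ i))).
by rewrite (negbTE ci) di.
Qed.

(** Rows increase, so the cells left of [c] hold exactly the smaller entries of its row. Hence the
    second row determines the tableau. *)
Lemma ccol_rank c :
  ccol c = #|[set i : 'I_n | (i < T c) &&
     ((i \in second_row T) == (T c \in second_row T))]|.
Proof.
have /SYTP[Tb Tr _] := ST; have [g gK Kg] := Tb.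
rewrite -{1}(card_row_prefix (ltnW (ccol_lt c))) -(card_imset _ (bij_inj Tb)).
congr #|pred_of_set _|; apply/setP => i; rewrite !inE mem_second_row.
apply/imsetP/andP => [[d + ->]|[ic ir]].
  rewrite inE => /andP[/eqP dr dc]; rewrite mem_second_row Tr //.
  by rewrite dr eqxx.
exists (g i); rewrite ?Kg // inE.
rewrite -(Kg i) mem_second_row -eq_crow_two_row in ir.
rewrite ir /= ltnNge leq_eqVlt; apply/negP => /predU1P[e|lt].
  by move: ic; rewrite -(cell_eq (eqP ir) (esym e)) Kg ltnn.
by have := Tr _ _ (esym (eqP ir)) lt; rewrite Kg; lia.
Qed.

Lemma second_row_ballot : ballot (second_row T).
Proof.
have /SYTP[Tb Tr Tc] := ST; have [g gK Kg] := Tb.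
apply/ballotP => m mn; rewrite npref_card //.
set A := [set i in _ | _].
(* [f i] is the entry directly above the second-row entry [i]; outside [A] its value is a dummy. *)
have /fin_all_exists[f fP] : forall i, exists j : 'I_n, i \in A -> j < i /\
   exists c, [/\ T c = j, crow c = 0 & ccol c = ccol (g i)].
  move=> i; case: (boolP (i \in A)) => iA; last by exists i.
  move: iA; rewrite inE -{1}(Kg i) mem_second_row => /andP[/eqP i1 im].
  have [|c [c0 ci]] := @cell_exists la 0 (ccol (g i)).
    by have := ccol_lt (g i); rewrite !nth_two_row i1 /=; lia.
  exists (T c) => _; split; last by exists c.
  by rewrite -[X in _ < nat_of_ord X](Kg i); apply: Tc; rewrite // c0 i1.
have f_inj : {in A &, injective f}.
  move=> i j iA jA e.
  have [_ [c [ci c0 cc]]] := fP i iA; have [_ [d [di d0 dc]]] := fP j jA.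
  have cd : c = d by apply: (bij_inj Tb); rewrite ci di.
  move: iA jA; rewrite !inE -{1}(Kg i) -{1}(Kg j) !mem_second_row.
  move=> /andP[/eqP i1 _] /andP[/eqP j1 _]; rewrite -(Kg i) -(Kg j).
  by congr (T _); apply: cell_eq; rewrite ?i1 ?j1 // -cc -dc cd.
(* [A] and [f @: A] are disjoint, of equal size, and both consist of entries below [m]. *)
rewrite mul2n -addnn -{1}(card_in_imset f_inj).
rewrite -[leqRHS](card_ord_lt mn) -cardsUI.
rewrite (_ : _ :&: _ = set0) ?cards0 ?addn0.
  apply/subset_leq_card/subsetP => x; rewrite !inE => /orP[/imsetP[i iA ->]|].
    by have [fi _] := fP i iA; move: iA; rewrite inE; lia.
  by case/andP.
apply/setP => x; rewrite !inE; apply/andP => -[/imsetP[i iA ->]].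
have [_ [c [<- c0 _]]] := fP i iA.
by rewrite mem_second_row c0.
Qed.

End Row.

Lemma second_row_inj : {in SYT n la &, injective (@second_row n la)}.
Proof.
move=> T U ST SU e; have /SYTP[[g gK Kg] _ _] := ST.
have /SYTP[[h hK Kh] _ _] := SU.
have gh i : g i = h i.
  apply: cell_eq.
    apply/eqP; rewrite eq_crow_two_row -(mem_second_row ST) -(mem_second_row SU).
    by rewrite Kg Kh e.
  by rewrite (ccol_rank ST) (ccol_rank SU) Kg Kh e.
by apply/ffunP => c; rewrite -[in RHS](gK c) gh Kh.
Qed.

(** Put [i] in the row given by membership in [R], at the column counting the smaller elements on
    the same side of [R]. The ballot condition is what makes the columns increase. *)
Lemma second_row_surj (R : {set 'I_n}) :
  ballot R -> #|R| = k -> exists2 T, T \in SYT n la & R = second_row T.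
Proof.
move=> /ballotP ball Rk.
pose rank (i : 'I_n) := #|[set j : 'I_n | (j < i) && ((j \in R) == (i \in R))]|.
have rank_lt i j : (i \in R) = (j \in R) -> i < j -> rank i < rank j.
  move=> eR ij; apply/proper_card/properP; split.
    apply/subsetP => x; rewrite !inE eR => /andP[xi ->].
    by rewrite (ltn_trans xi ij).
  by exists i; rewrite !inE ?ij ?ltnn ?eR ?eqxx.
have /fin_all_exists[g gP] : forall i, exists c : cell la,
    crow c = (i \in R) /\ ccol c = rank i.
  move=> i; apply: cell_exists; rewrite nth_two_row.
  (* The counted set omits [i] itself, so the column stays within the row length. *)
  have: [set j : 'I_n | (j < i) && ((j \in R) == (i \in R))] \proper
        if i \in R then R else ~: R.
    apply/properP; split.
      by apply/subsetP => j; case: (boolP (i \in R)) => iR; rewrite !inE;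
         case: (j \in R) => /andP[].
    by exists i; rewrite ?inE ?ltnn //; case: (boolP (i \in R)) => iR; rewrite ?inE.
  move/proper_card; rewrite -/(rank i).
  by case: (i \in R) => /=; rewrite ?[#|~: R|]cardsCs ?setCK ?card_ord Rk.
have g_inj : injective g.
  move=> i j e; have [ri ci] := gP i; have [rj cj] := gP j.
  have eR : (i \in R) = (j \in R).
    by move: ri; rewrite e rj; case: (i \in R) (j \in R) => [] [].
  move: ci; rewrite e cj => eq_rank; apply/val_inj.
  case: (ltngtP i j) => // lt; first by have := rank_lt _ _ eR lt; lia.
  by have := rank_lt _ _ (esym eR) lt; lia.
have [h gK hK] : bijective g.
  by apply: inj_card_bij; rewrite // card_cell sumn_two_row card_ord.
pose T : {ffun cell la -> 'I_n} := [ffun c => h c].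
have crowR c : crow c = (h c \in R) by have [<- _] := gP (h c); rewrite hK.
have ccolR c : ccol c = rank (h c) by have [_ <-] := gP (h c); rewrite hK.
exists T; last first.
  apply/setP => i; apply/idP/imsetP => [iR|[c]].
    exists (g i); rewrite ?ffunE ?gK // inE.
    by have [-> _] := gP i; rewrite iR.
  by rewrite inE crowR ffunE => + ->; case: (_ \in _).
apply/SYTP; split.
- by exists g => x; rewrite ffunE ?gK ?hK.
- move=> c d; rewrite !crowR !ccolR !ffunE => eR.
  have {}eR : (h c \in R) = (h d \in R).
    by case: (h c \in R) (h d \in R) eR => [] [].
  case: (ltngtP (h c) (h d)) => //; last by move=> /val_inj ->; rewrite ltnn.
  by move=> /(rank_lt _ _ (esym eR)); lia.
- move=> c d; rewrite !crowR !ccolR !ffunE => e.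
  case cR: (h c \in R); case dR: (h d \in R) => // _.
  case: (ltngtP (h c) (h d)) => //; last first.
    by move=> /val_inj eq; rewrite eq dR in cR.
  (* If [h d < h c], the elements up to [h d] comprise [rank (h d) + 1] elements of [R] and at most
     [rank (h c) = rank (h d)] others, against the ballot condition at [(h d).+1]. *)
  move=> dc; have := ball (h d).+1 (ltn_ord _); rewrite npref_card //.
  have -> : [set i in R | i < (h d).+1] =
      h d |: [set j : 'I_n | (j < h d) && ((j \in R) == (h d \in R))].
    apply/setP => x; rewrite !inE dR ltnS leq_eqVlt eqb_id.
    case: (x =P h d) => [->|/eqP xd] /=; first by rewrite dR eqxx.
    by rewrite (negbTE (_ : val x != h d)) // andbC.
  rewrite cardsU1 inE ltnn /= -/(rank (h d)) => le.
  have sub : [set j : 'I_n | j < (h d).+1] \subset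
      h d |: [set j : 'I_n | (j < h d) && ((j \in R) == (h d \in R))]
      :|: [set j : 'I_n | (j < h c) && ((j \in R) == (h c \in R))].
    apply/subsetP => x; rewrite !inE cR dR eqb_id eqbF_neg ltnS leq_eqVlt.
    case/predU1P => [/val_inj ->|xd]; first by rewrite eqxx.
    by rewrite xd (ltn_trans xd dc) /=; case: (x \in R); rewrite ?orbT.
  have := subset_leq_card sub; rewrite card_ord_lt // => {}sub.
  have := leq_of_leqif (leq_card_setU (h d |: [set j : 'I_n | (j < h d) &&
    ((j \in R) == (h d \in R))]) [set j : 'I_n | (j < h c) &&
    ((j \in R) == (h c \in R))]).
  rewrite cardsU1 inE ltnn /= -/(rank (h d)) -/(rank (h c)) => le'.
  have := leq_trans sub le'; rewrite e; lia.
Qed.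

Lemma sum_SYT_two_row (M : nmodType) (G : {set 'I_n.-1} -> M) :
  (\sum_(T in SYT n la) G (Des T) =
   \sum_(R : {set 'I_n} | ballot R && (#|R| == k)) G (fall_set (~: R)))%R.
Proof.
transitivity (\sum_(R in @second_row n la @: SYT n la) G (fall_set (~: R)))%R.
  rewrite big_imset /=; last exact: second_row_inj.
  by apply: eq_bigr => T ST; rewrite Des_two_row.
apply: eq_bigl => R; apply/imsetP/andP => [[T ST ->]|[ball /eqP Rk]].
  by rewrite second_row_ballot // card_second_row.
by have [T ST RT] := second_row_surj ball Rk; exists T.
Qed.
End TwoRow.

(** * Standardization *)

Lemma xmonom_bij (I J : finType) (T : I -> J) (u : {ffun J -> nat}) :
  bijective T -> xmonom [ffun c => u (T c)] = xmonom u.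
Proof.
move=> Tb; have [g gK Kg] := Tb; apply/fsfunP => x; rewrite !xmonomE.
rewrite -(card_imset _ (bij_inj Tb)); congr #|pred_of_set _|.
apply/setP => j; rewrite inE; apply/imsetP/idP => [[i + ->]|uj].
  by rewrite inE ffunE.
by exists (g j); rewrite ?inE ?ffunE Kg.
Qed.

(* The order of the entries of the standardization of S: equal entries of S are
   ordered from left to right. *)
Definition standard_lt la (S : cell la -> nat) (c d : cell la) : bool :=
  (S c < S d) || (S c == S d) && (ccol c < ccol d).

Lemma standard_lt_irr la (S : cell la -> nat) c : standard_lt S c c = false.
Proof. by rewrite /standard_lt !ltnn andbF. Qed.

Lemma standard_lt_trans la (S : cell la -> nat) : transitive (standard_lt S).
Proof. by rewrite /standard_lt => d c e; lia. Qed.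

(** Names the condition on words inside [fundamental]. *)
Definition compatible n (D : {set 'I_n.-1}) (w : {ffun 'I_n -> nat}) : bool :=
  [forall i : 'I_n, forall j : 'I_n, (i <= j)%N ==> (w i <= w j)%N] &&
  [forall j in D, (w (elt j) < w (elt_succ j))%N].

Lemma compatibleP n (D : {set 'I_n.-1}) (w : {ffun 'I_n -> nat}) :
  reflect ((forall i j : 'I_n, i <= j -> w i <= w j) /\
           (forall j, j \in D -> w (elt j) < w (elt_succ j)))
    (compatible D w).
Proof.
apply: (iffP andP) => -[h1 h2]; split.
- by move=> i j; move/'forall_forallP: h1 => /(_ i j)/implyP.
- by move=> j; move/'forall_implyP: h2; apply.
- by apply/'forall_forallP => i j; apply/implyP; apply: h1.
- by apply/'forall_implyP.
Qed.

Lemma semistandardP la (S : {ffun cell la -> nat}) :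
  reflect ((forall c d, crow c = crow d -> ccol c < ccol d -> S c <= S d) /\
           (forall c d, ccol c = ccol d -> crow c < crow d -> S c < S d))
    (semistandard S).
Proof.
apply: (iffP andP) => -[h1 h2]; split.
- by move=> c d /eqP e l; move/'forall_forallP: h1 => /(_ c d); rewrite e l.
- by move=> c d /eqP e l; move/'forall_forallP: h2 => /(_ c d); rewrite e l.
- by apply/'forall_forallP => c d; apply/implyP => /andP[/eqP]; apply: h1.
- by apply/'forall_forallP => c d; apply/implyP => /andP[/eqP]; apply: h2.
Qed.

Section Standardization.
Variables (n : nat) (la : seq nat).
Hypotheses (la_sorted : sorted geq la) (la_n : sumn la = n).

(** Rows weakly shorten downwards, so the diagram contains this corner; the next two comparisons go
    through it, along a row and then down a column. *)
Lemma northwest_cell (c d : cell la) :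
  crow c <= crow d -> exists e : cell la, crow e = crow c /\ ccol e = ccol d.
Proof.
move=> cd; apply: cell_exists; apply: leq_trans (ccol_lt d) _.
case: (ltnP (crow d) (size la)) => dl; last by rewrite nth_default.
have geq_trans : transitive geq by move=> x y z xy yz; apply: leq_trans yz xy.
apply: (sorted_leq_nth geq_trans leqnn 0 la_sorted) => //.
by rewrite inE (leq_ltn_trans cd).
Qed.

Lemma SYT_northwest (T : {ffun cell la -> 'I_n}) c d : T \in SYT n la ->
  crow c <= crow d -> ccol c <= ccol d -> T c <= T d.
Proof.
move=> /SYTP[_ Tr Tc] cd; have [e [er ec]] := northwest_cell cd.
move=> cd'; apply: (@leq_trans (T e)).
  move: cd'; rewrite -ec leq_eqVlt => /predU1P[ce|]; last first.
    by move=> /(Tr _ _ (esym er)) /ltnW.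
  by rewrite (@cell_eq _ c e).
move: cd; rewrite -er leq_eqVlt => /predU1P[ed|]; last first.
  by move=> /(Tc _ _ ec) /ltnW.
by rewrite (@cell_eq _ e d).
Qed.

Lemma semistandard_northwest (S : {ffun cell la -> nat}) c d : semistandard S ->
  crow c < crow d -> ccol c <= ccol d -> S c < S d.
Proof.
move=> /semistandardP[Sr Sc] cd; have [e [er ec]] := northwest_cell (ltnW cd).
move=> cd'; apply: (@leq_ltn_trans (S e)); last by apply: Sc; rewrite ?er.
move: cd'; rewrite -ec leq_eqVlt => /predU1P[ce|]; last exact: Sr.
by rewrite (@cell_eq _ c e).
Qed.

(** Equal entries of a semistandard filling never share a column, so left-to-right order separates
    them. *)
Lemma standard_lt_total (S : {ffun cell la -> nat}) c d :
  semistandard S -> c != d -> standard_lt S c d || standard_lt S d c.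
Proof.
move=> SS cd; rewrite /standard_lt.
case: (ltngtP (S c) (S d)) => //= Scd.
case: (ltngtP (ccol c) (ccol d)) => //= ecol.
case: (ltngtP (crow c) (crow d)) => erow.
- by have := semistandard_northwest SS erow (eq_leq ecol); lia.
- by have := semistandard_northwest SS erow (eq_leq (esym ecol)); lia.
- by rewrite (cell_eq erow ecol) eqxx in cd.
Qed.

(* Between equal values of w there is no descent of T, so that the cells move
   weakly up and hence strictly to the right. *)
Lemma compatible_standard_lt (T : {ffun cell la -> 'I_n}) w c d :
  T \in SYT n la -> compatible (Des T) w ->
  T c < T d -> standard_lt (fun c => w (T c)) c d.
Proof.
move=> ST /compatibleP[wle wlt] cd; rewrite /standard_lt.
rewrite [_ < _]ltn_neqAle (wle _ _ (ltnW cd)) andbT.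
case: (w (T c) =P w (T d)) => //= ecd.
(* Induction on the distance, replacing [T d] by its predecessor [elt x], whose cell lies strictly
   left of [d]. *)
have [m] := ubnP (T d - T c); elim: m d cd ecd => // m IHm d cd ecd lt.
have dn := ltn_ord (T d).
have xP : (T d).-1 < n.-1 by lia.
pose x := Ordinal xP.
have /SYTP[[g gK Kg] _ _] := ST.
have sx : elt_succ x = T d by apply: val_inj; rewrite /=; lia.
have ex : val (elt x) = (T d).-1 by [].
have w1 : w (T c) <= w (elt x) by apply: wle; rewrite /=; lia.
have w2 : w (elt x) <= w (T d) by apply: wle; rewrite /=; lia.
have step : ccol (g (elt x)) < ccol d.
  rewrite ltnNge; apply/negP => col.
  have row : crow d <= crow (g (elt x)).
    rewrite leqNgt; apply/negP => row.
    have : x \in Des T.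
      rewrite inE; apply/existsP; exists (g (elt x)).
      by apply/existsP; exists d; rewrite Kg sx !eqxx.
    by move/wlt; rewrite sx; lia.
  by have := SYT_northwest ST row col; rewrite Kg ex; lia.
move: cd; rewrite leq_eqVlt => /orP[/eqP cd|cd].
  suff -> : c = g (elt x) by [].
  by rewrite -(gK c); congr g; apply: val_inj; rewrite ex -cd.
apply: ltn_trans step; apply: IHm; rewrite Kg ?ex; lia.
Qed.

(** Recovers [T] from the filling [w (T c)] alone, as needed for the injectivity in
    [schur_fundamental]. *)
Lemma SYT_rank (T : {ffun cell la -> 'I_n}) w c :
  T \in SYT n la -> compatible (Des T) w ->
  nat_of_ord (T c) = #|[set d | standard_lt (fun c => w (T c)) d c]|.
Proof.
move=> ST Cw; have /SYTP[Tb _ _] := ST; have [g gK Kg] := Tb.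
rewrite -[LHS](@card_ord_lt n) ?(ltnW (ltn_ord _)) //.
rewrite -(card_imset _ (bij_inj Tb)); congr #|pred_of_set _|.
apply/setP => i; rewrite inE; apply/idP/imsetP => [ic|[d + ->]].
  by exists (g i); rewrite ?Kg // inE; apply: compatible_standard_lt; rewrite ?Kg.
rewrite inE; case: (ltngtP (T d) (T c)) => // [cd dc|/val_inj/(bij_inj Tb)->].
  have := standard_lt_trans dc (compatible_standard_lt ST Cw cd).
  by rewrite standard_lt_irr.
by rewrite standard_lt_irr.
Qed.

Lemma compatible_semistandard (T : {ffun cell la -> 'I_n}) w :
  T \in SYT n la -> compatible (Des T) w -> semistandard [ffun c => w (T c)].
Proof.
move=> ST Cw; have /SYTP[_ Tr Tc] := ST; have /compatibleP[wle _] := Cw.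
apply/semistandardP; split=> c d; rewrite !ffunE => e l.
  exact/wle/ltnW/Tr.
have := compatible_standard_lt ST Cw (Tc _ _ e l).
by rewrite /standard_lt e ltnn andbF orbF.
Qed.

(** [T] ranks the cells by [standard_lt S], a strict total order on cells because [S] is
    semistandard. *)
Lemma standardization (S : {ffun cell la -> nat}) : semistandard S ->
  exists T : {ffun cell la -> 'I_n}, T \in SYT n la /\
    forall w : {ffun 'I_n -> nat}, (forall c, w (T c) = S c) ->
      compatible (Des T) w.
Proof.
move=> SS; have /semistandardP[Sr Sc] := SS.
have card_n : #|{: cell la}| = n by rewrite card_cell.
pose rank c := #|[set d | standard_lt S d c]|.
have rank_n c : rank c < n.
  rewrite -card_n -cardsT; apply/proper_card/properP; split; first exact: subsetT.
  by exists c; rewrite !inE // standard_lt_irr.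
have rank_lt c d : standard_lt S c d -> rank c < rank d.
  move=> cd; apply/proper_card/properP; split.
    by apply/subsetP => e; rewrite !inE => /standard_lt_trans; apply.
  by exists c; rewrite inE // standard_lt_irr.
pose T : {ffun cell la -> 'I_n} := [ffun c => Ordinal (rank_n c)].
have T_lt c d : standard_lt S c d -> T c < T d.
  by rewrite !ffunE; apply: rank_lt.
have T_inj : injective T.
  move=> c d e; apply/eqP/negPn/negP => /(standard_lt_total SS).
  by case/orP=> /T_lt; rewrite e ltnn.
have T_bij : bijective T by apply: inj_card_bij; rewrite // card_n card_ord.
have lt_T c d : T c < T d -> standard_lt S c d.
  move=> cd; have : c != d by apply: contraTneq cd => ->; rewrite ltnn.
  by case/(standard_lt_total SS)/orP => // /T_lt; lia.
exists T; split.
  apply/SYTP; split=> // c d e l; apply: T_lt; rewrite /standard_lt.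
    by have := Sr _ _ e l; rewrite l andbT orbC -leq_eqVlt.
  by rewrite Sc.
move=> w wS; apply/compatibleP; split.
  have [g gK Kg] := T_bij => i j; rewrite -(Kg i) -(Kg j) !wS leq_eqVlt.
  case/predU1P => [/val_inj/T_inj -> //|/lt_T].
  by rewrite /standard_lt; lia.
move=> j; rewrite inE => /existsP[c /existsP[d /and3P[/eqP ec /eqP ed cd]]].
rewrite -ec -ed !wS; have : T c < T d by rewrite ec ed /=.
(* At a descent, equal values would put [c] strictly left of [d] as well as above it, where
   semistandardness already forces a strict increase. *)
move/lt_T; rewrite /standard_lt => /orP[//|/andP[_ l]].
exact: semistandard_northwest (ltnW l).
Qed.

(** The map sending [(T, w)] to the filling [w (T c)] is a bijection from standard tableaux with a
    compatible word onto semistandard fillings, and it preserves the monomial. *)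
Lemma schur_fundamental (m : monom) :
  (schur la m = \sum_(T in SYT n la) fundamental (Des T) m)%R.
Proof.
rewrite /schur /fundamental /genseries -natr_sum; congr _%:R%R.
pose W (T : {ffun cell la -> 'I_n}) := [set w : {ffun 'I_n -> finsupp m} |
   compatible (Des T) [ffun i => val (w i)] & xmonom [ffun i => val (w i)] == m].
rewrite (eq_bigr (fun T => \sum_(w in W T) 1)) => [|T _]; last first.
  by rewrite sum1_card.
rewrite pair_big_dep /= sum1_card -cardsE.
set Z := [set p | _].
have ZE T w : ((T, w) \in Z) = [&& T \in SYT n la,
    compatible (Des T) [ffun i => val (w i)] &
    xmonom [ffun i => val (w i)] == m].
  rewrite /Z in_set unfold_in /=; congr (_ && _); exact: in_set.
pose f (p : {ffun cell la -> 'I_n} * {ffun 'I_n -> finsupp m}) :=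
  [ffun c => p.2 (p.1 c)].
have fE p c : val (f p c) = [ffun i => val (p.2 i)] (p.1 c) by rewrite !ffunE.
have f_inj : {in Z &, injective f}.
  move=> [T w] [U v]; rewrite !ZE => /and3P[ST Cw _] /and3P[SU Cv _] e.
  have ec c : w (T c) = v (U c) by have /ffunP/(_ c) := e; rewrite !ffunE.
  have TU : T = U.
    apply/ffunP => c; apply: val_inj; rewrite /= (SYT_rank c ST Cw).
    rewrite (SYT_rank c SU Cv); congr #|pred_of_set _|.
    by apply/setP => d; rewrite !inE /standard_lt !ffunE !ec.
  rewrite -TU in ec *; congr (_, _); apply/ffunP => i.
  by have /SYTP[[g gK Kg] _ _] := ST; rewrite -(Kg i) ec.
rewrite -(card_in_imset f_inj); congr #|pred_of_set _|.
apply/setP => S; rewrite inE; apply/andP/imsetP => [[SS Sm]|[[T w] TwZ ->]].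
  have [T [ST Tw]] := standardization SS.
  have /SYTP[Tb _ _] := ST; have [g gK Kg] := Tb.
  pose w : {ffun 'I_n -> finsupp m} := [ffun i => S (g i)].
  have Sw : S = f (T, w) by apply/ffunP => c; rewrite !ffunE /= gK.
  exists (T, w) => //; rewrite ZE ST Tw /= => [|c]; last first.
    by rewrite !ffunE gK.
  rewrite -(xmonom_bij _ Tb); move: Sm; congr (xmonom _ == _).
  by apply/ffunP => c; rewrite !ffunE gK.
move: TwZ; rewrite ZE => /and3P[ST Cw wm].
have -> : [ffun i => val (f (T, w) i)] = [ffun c => [ffun i => val (w i)] (T c)].
  by apply/ffunP => c; rewrite [LHS]ffunE [RHS]ffunE fE.
have /SYTP[Tb _ _] := ST.
by rewrite compatible_semistandard // xmonom_bij.
Qed.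

End Standardization.

(** * The two expansions *)

Lemma stirling_ge2_1 c : stirling_ge2 1 c = 0.
Proof.
apply/eqP; rewrite cards_eq0; apply/eqP/setP => P; rewrite !inE.
apply/and3P => -[/and3P[/eqP cP _ _] _ /'forall_implyP P2].
have : ord0 \in cover P by rewrite cP inE.
case/bigcupP => B BP _; have := leq_trans (P2 B BP) (max_card _).
by rewrite card_ord.
Qed.

(** For [k = 1] the definition stops at [t = n - 2]; the term [t = n - 1] may be added since a
    single point admits no block of size 2. *)
Lemma ecoefE n b k : 0 < n -> k.*2 <= n ->
  ecoef n b k =
    \sum_(t < n.+1 | k <= t <= n - k) stirling_ge2 (n - t) (b%:Z - t%:Z)%R.
Proof.
move=> n0 kn; transitivity
    (\sum_(k <= t < (n - k).+1) stirling_ge2 (n - t) (b%:Z - t%:Z)%R).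
  rewrite /ecoef; case: eqP => // k1.
  case: n n0 kn => [//|[|m]] _; rewrite k1 // => _.
  rewrite subn1 /= [RHS]big_nat_recr //= subSS subSnn stirling_ge2_1.
  by rewrite addn0.
rewrite (big_nat_widen _ _ n.+1) ?ltnS ?leq_subr //.
rewrite (big_nat_widenl _ 0) // big_mkord.
by apply: eq_bigl => t /=; rewrite andbC ltnS.
Qed.

(** * Summation over set partitions with an arbitrary weight *)

Section Sum.
Variables (M : nmodType) (n b : nat) (G : {set 'I_n.-1} -> M).
Hypothesis n_gt0 : 0 < n.
Local Open Scope ring_scope.

Lemma sum_by_card (p : nat) (Q : pred {set 'I_n}) (F : {set 'I_n} -> M) :
    (forall A, Q A -> (#|A| < p)%N) ->
  \sum_(A | Q A) F A = \sum_(t < p) \sum_(A | Q A && (#|A| == t)) F A.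
Proof.
case: p => [|p] Qp; first by rewrite big_ord0 big_pred0 // => A; apply/negP => /Qp.
(* The bound on [#|A|] makes [inord] faithful on [Q]. *)
rewrite (partition_big (fun A : {set 'I_n} => inord #|A| : 'I_p.+1)
  xpredT) //.
apply: eq_bigr => t _; apply: eq_bigl => A; case: (boolP (Q A)) => //= QA.
by rewrite -val_eqE /= inordK ?Qp.
Qed.

Lemma sum_Desing :
  \sum_(P in PSet n b) G (Desing P) =
    \sum_(k < (n./2).+1)
      (\sum_(T in SYT n (two_row n k)) G (Des T)) *+ ecoef n b k.
Proof.
pose s t := stirling_ge2 (n - t) (b%:Z - t%:Z).
(* Group the partitions by their set of singletons. *)
transitivity (\sum_(A : {set 'I_n}) G (fall_set A) *+ s #|A|).
  rewrite (partition_big (@Sing n) xpredT) //=; apply: eq_bigr => A _.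
  rewrite /s -card_PSet_Sing -sumr_const.
  by apply: eq_big => [P|P /andP[_ /eqP<-]] //; rewrite [RHS]inE.
transitivity (\sum_(t < n.+1)
    \sum_(R : {set 'I_n} | ballot R && (#|R| <= t <= n - #|R|)%N)
      G (fall_set (~: R)) *+ s t).
  rewrite (@sum_by_card n.+1) => [|A _]; last first.
    by rewrite ltnS -[leqRHS]card_ord max_card.
  apply: eq_bigr => t _; rewrite [RHS]sumrMnl -sum_fall_set -sumrMnl.
  by apply: eq_bigr => A /eqP->.
(* Exchange the sums: for fixed [R], the admissible [t] are those in the range of [ecoefE] with
   [k = #|R|]. *)
transitivity (\sum_(R : {set 'I_n} | ballot R)
    G (fall_set (~: R)) *+ ecoef n b #|R|).
  rewrite (exchange_big_dep (@ballot n)) /=; last by move=> t R _ /andP[].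
  apply: eq_bigr => R bR; rewrite ecoefE //; last first.
    by have /ballotP/(_ n (leqnn n)) := bR; rewrite npref_indic -mul2n.
  by rewrite -sumrMnr; apply: eq_bigl => t; rewrite bR.
(* The ballot condition at the full length [n] gives [2 * #|R| <= n], which bounds [k] by [n./2]. *)
rewrite (@sum_by_card (n./2).+1) => [|R /ballotP/(_ n (leqnn n))]; last first.
  by rewrite npref_indic mul2n ltnS geq_half_double.
apply: eq_bigr => k _; rewrite sum_SYT_two_row -?sumrMnl.
  by apply: eq_bigr => R /andP[_ /eqP->].
by rewrite -geq_half_double -ltnS.
Qed.

End Sum.

Local Open Scope ring_scope.

Theorem theorem6p3 (n b : nat) (hb : (1 <= b <= n)%N) :
  \sum_(P in PSet n b) qpow (Desing P) =
    \sum_(k < (n./2).+1)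
      (ecoef n b k)%:R * (\sum_(T in SYT n (two_row n k)) qpow (Des T))
  /\
  forall m : monom,
    \sum_(P in PSet n b) fundamental (Desing P) m =
      \sum_(k < (n./2).+1) (ecoef n b k)%:R * schur (two_row n k) m.
Proof.
have n_gt0 : (0 < n)%N by lia.
split=> [|m].
  rewrite (sum_Desing b (@qpow n) n_gt0); apply: eq_bigr => k _.
  by rewrite mulr_natl.
(* The second identity is checked coefficientwise, with the coefficient at [m] as weight. *)
rewrite (sum_Desing b (fun D => fundamental D m) n_gt0).
apply: eq_bigr => k _; rewrite mulr_natl.
have kn : (k.*2 <= n)%N.
  by rewrite -geq_half_double -ltnS.
rewrite (schur_fundamental (n := n)) ?sumn_two_row //.
by rewrite /two_row; case: eqP => //= _; rewrite andbT /geq /=; lia.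
Qed.
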